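(* Let $T$ be a Lie triple system over a field $\mathbb{F}$, let $U$ be a subspace of $T$ with $T=U\oplus[T,T,T]$ (direct sum of vector spaces), let $\breve{T}=Tt+Tt^{3}=Tt+Ut^{3}+[T,T,T]t^{3}$ be the associated Lie triple system, and let $\varphi:\mathrm{QDer}(T)\to\mathrm{End}(\breve{T})$ be given by $$\varphi(D)(at+ut^{3}+bt^{3})=D(a)t+D'(b)t^{3}\qquad(a\in T,\ u\in U,\ b\in[T,T,T]),$$ where $D'\in\mathrm{End}(T)$ is any map with $[D(x),y,z]+[x,D(y),z]+[x,y,D(z)]=D'([x,y,z])$ for all $x,y,z\in T$. Then: (1) $\varphi$ is injective, and $\varphi(D)$ does not depend on the choice of $D'$. (2) $\varphi(\mathrm{QDer}(T))\subseteq\mathrm{Der}(\breve{T})$.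
   Context: A Lie triple system over a field $\mathbb{F}$ is a vector space $T$ over $\mathbb{F}$ with a trilinear map $[\cdot,\cdot,\cdot]:T\times T\times T\to T$ such that for all $x,y,z,u,v\in T$: $[x,x,z]=0$; $[x,y,z]+[y,z,x]+[z,x,y]=0$; $[x,y,[z,u,v]]=[[x,y,z],u,v]+[z,[x,y,u],v]+[z,u,[x,y,v]]$. $\mathrm{End}(T)$ is the set of all linear maps $T\to T$. $[T,T,T]$ is the linear span of all $[x,y,z]$. A derivation of $T$ is $D\in\mathrm{End}(T)$ with $[D(x),y,z]+[x,D(y),z]+[x,y,D(z)]=D([x,y,z])$ for all $x,y,z\in T$; $\mathrm{Der}(T)$ is the set of derivations. A quasiderivation of $T$ is $D\in\mathrm{End}(T)$ for which there exists $D'\in\mathrm{End}(T)$ with $[D(x),y,z]+[x,D(y),z]+[x,y,D(z)]=D'([x,y,z])$ for all $x,y,z\in T$; $\mathrm{QDer}(T)$ is the set of quasiderivations. For an indeterminate $t$, $\breve{T}=\{x\otimes t+y\otimes t^{3}\mid x,y\in T\}$, with $xt^i$ written for $x\otimes t^i$. It is a Lie triple system with the trilinear bracket determined by $[xt^{i},yt^{j},zt^{k}]=[x,y,z]t^{i+j+k}$ for $x,y,z\in T$ and $i,j,k\in\{1,3\}$, where $t^{m}$ is taken to be $0$ for $m\geq 4$ (so $[xt,yt,zt]=[x,y,z]t^3$ and all other brackets of this kind vanish). *)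

(* Defs.v *)
From HB Require Import structures.
From mathcomp Require Import all_boot all_algebra.
From mathcomp Require Import boolp classical_sets.

Set Implicit Arguments.
Unset Strict Implicit.
Unset Printing Implicit Defensive.

Import GRing.Theory.

Local Open Scope ring_scope.
Local Open Scope classical_set_scope.

HB.mixin Record isLieTriple (F : fieldType) T of GRing.Lmodule F T := {
  tribr : T -> T -> T -> T;
  tribr_linear1 : forall y z : T, linear (fun x : T => tribr x y z);
  tribr_linear2 : forall x z : T, linear (fun y : T => tribr x y z);
  tribr_linear3 : forall x y : T, linear (fun z : T => tribr x y z);
  tribr_alt : forall x z : T, tribr x x z = 0;
  tribr_cyclic : forall x y z : T,
    tribr x y z + tribr y z x + tribr z x y = 0;
  tribr_jacobi : forall x y z u v : T,
    tribr x y (tribr z u v)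
    = tribr (tribr x y z) u v + tribr z (tribr x y u) v
      + tribr z u (tribr x y v)
}.

#[short(type="lieTripleType")]
HB.structure Definition LieTriple (F : fieldType) :=
  {T of GRing.Lmodule F T & isLieTriple F T}.

Notation "[< x , y , z >]" := (tribr x y z)
  (at level 0, x, y, z at level 99, format "[<  x ,  y ,  z  >]") : ring_scope.

Definition lspan (F : fieldType) (V : lmodType F) (S : set V) : {pred V} :=
  fun v => `[< exists (n : nat) (c : 'I_n -> F) (s : 'I_n -> V),
    (forall i, S (s i)) /\ v = \sum_(i < n) c i *: s i >].

Definition brackets (F : fieldType) (T : lieTripleType F) : set T :=
  [set w | exists x y z : T, w = [< x, y, z >]].
Arguments brackets {F} T.

Definition derived (F : fieldType) (T : lieTripleType F) : {pred T} :=
  lspan (brackets T).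
Arguments derived {F} T.

Definition direct_sum (F : fieldType) (V : lmodType F) (U W : {pred V}) : Prop :=
  (forall v, exists u w, [/\ u \in U, w \in W & v = u + w]) /\
  (forall v, v \in U -> v \in W -> v = 0).

Definition Der (F : fieldType) (T : lieTripleType F) : set {linear T -> T} :=
  [set D | forall x y z : T,
    [< D x, y, z >] + [< x, D y, z >] + [< x, y, D z >] = D [< x, y, z >]].
Arguments Der {F} T.

Definition companion (F : fieldType) (T : lieTripleType F)
    (D D' : {linear T -> T}) : Prop :=
  forall x y z : T,
    [< D x, y, z >] + [< x, D y, z >] + [< x, y, D z >] = D' [< x, y, z >].

Definition QDer (F : fieldType) (T : lieTripleType F) : set {linear T -> T} :=
  [set D | exists D' : {linear T -> T}, companion D D'].
Arguments QDer {F} T.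

Lemma lspan_submod_closed (F : fieldType) (V : lmodType F) (S : set V) :
  submod_closed (lspan S).
Proof.
split=> [|a v w /asboolP[n [c [s [Ss ->]]]] /asboolP[m [d [r [Sr ->]]]]].
  apply/asboolP; exists 0%N, (fun=> 0), (fun=> 0).
  by split=> [[]|] //; rewrite big_ord0.
apply/asboolP; exists (n + m)%N,
  (fun i => match split i with inl j => a * c j | inr j => d j end),
  (fun i => match split i with inl j => s j | inr j => r j end).
split=> [i|]; first by case: (split i).
rewrite big_split_ord scaler_sumr /=; congr (_ + _); apply: eq_bigr => i _.
  by rewrite (unsplitK (inl i)) scalerA.
by rewrite (unsplitK (inr i)).
Qed.

HB.instance Definition _ (F : fieldType) (T : lieTripleType F) :=
  GRing.isSubmodClosed.Build F T (derived T) (lspan_submod_closed (brackets T)).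

Section BracketTheory.
Context (F : fieldType) (T : lieTripleType F).
Implicit Types x y z : T.

Lemma tribr0l y z : [< 0, y, z >] = 0.
Proof.
by have := tribr_linear1 y z (-1) 0 0; rewrite scaler0 addr0 scaleN1r addNr.
Qed.

Lemma tribr0m x z : [< x, 0, z >] = 0.
Proof.
by have := tribr_linear2 x z (-1) 0 0; rewrite scaler0 addr0 scaleN1r addNr.
Qed.

Lemma tribr0r x y : [< x, y, 0 >] = 0.
Proof.
by have := tribr_linear3 x y (-1) 0 0; rewrite scaler0 addr0 scaleN1r addNr.
Qed.

End BracketTheory.

(* The pair (x, y) stands for x t + y t^3; see [tmon] and [breve_brE]. *)
Definition breve (F : fieldType) (T : lieTripleType F) : Type := (T * T)%type.

HB.instance Definition _ (F : fieldType) (T : lieTripleType F) :=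
  GRing.Lmodule.on (breve T).

(* x t^i, with t^i = 0 for i >= 4; only odd exponents are ever used. *)
Definition tmon (F : fieldType) (T : lieTripleType F) (x : T) (i : nat) :
    breve T :=
  match i with 1%N => (x, 0) | 3%N => (0, x) | _ => 0 end.

Definition breve_br (F : fieldType) (T : lieTripleType F)
  (p q r : breve T) : breve T := tmon [< p.1, q.1, r.1 >] 3.

Lemma breve_decomp (F : fieldType) (T : lieTripleType F) (p : breve T) :
  p = tmon p.1 1 + tmon p.2 3.
Proof. by case: p => x y; congr pair; rewrite /= ?addr0 ?add0r. Qed.

Lemma breve_brE (F : fieldType) (T : lieTripleType F) (x y z : T)
    (i j k : nat) : i \in [:: 1; 3]%N -> j \in [:: 1; 3]%N ->
    k \in [:: 1; 3]%N ->
  breve_br (tmon x i) (tmon y j) (tmon z k) = tmon [< x, y, z >] (i + j + k).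
Proof.
rewrite !inE => /orP[]/eqP-> /orP[]/eqP-> /orP[]/eqP->;
  by rewrite /breve_br /= ?tribr0l ?tribr0m ?tribr0r.
Qed.

Section BreveLieTriple.
Context (F : fieldType) (T : lieTripleType F).
Implicit Types p q r u v : breve T.

Let tmon3_linear : linear (fun x : T => tmon x 3).
Proof. by move=> a x y; congr pair; rewrite /= ?scaler0 ?addr0. Qed.

Let tmon30 : tmon (0 : T) 3 = 0. Proof. by []. Qed.

Let tmon3D (x y : T) : tmon x 3 + tmon y 3 = tmon (x + y) 3.
Proof. by have := tmon3_linear 1 x y; rewrite !scale1r. Qed.

Fact breve_linear1 q r : linear (fun p => breve_br p q r).
Proof. by move=> a p p'; rewrite -tmon3_linear -tribr_linear1. Qed.

Fact breve_linear2 p r : linear (fun q => breve_br p q r).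
Proof. by move=> a q q'; rewrite -tmon3_linear -tribr_linear2. Qed.

Fact breve_linear3 p q : linear (fun r => breve_br p q r).
Proof. by move=> a r r'; rewrite -tmon3_linear -tribr_linear3. Qed.

Fact breve_alt p r : breve_br p p r = 0.
Proof. by rewrite /breve_br tribr_alt. Qed.

Fact breve_cyclic p q r : breve_br p q r + breve_br q r p + breve_br r p q = 0.
Proof. by rewrite /breve_br !tmon3D tribr_cyclic. Qed.

Fact breve_jacobi p q r u v :
  breve_br p q (breve_br r u v)
  = breve_br (breve_br p q r) u v + breve_br r (breve_br p q u) v
    + breve_br r u (breve_br p q v).
Proof. by rewrite /breve_br /= !(tribr0l, tribr0m, tribr0r) !tmon3D !addr0. Qed.

HB.instance Definition _ := isLieTriple.Build F (breve T)
  breve_linear1 breve_linear2 breve_linear3 breve_alt breve_cyclic breve_jacobi.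

End BreveLieTriple.

Section Projection.
Context (F : fieldType) (V : lmodType F) (U W : submodClosed V).
Hypothesis UW : direct_sum U W.

Let decomp v : exists w, (w \in W) && (v - w \in U).
Proof.
have [u [w [Uu Ww ->]]] := UW.1 v.
by exists w; rewrite Ww addrK.
Qed.

(* Projection onto W along U. *)
Definition dproj v : V := xchoose (decomp v).

Let submodB (S : submodClosed V) x y : x \in S -> y \in S -> x - y \in S.
Proof. by move=> Sx Sy; rewrite -scaleN1r rpredD // rpredZ. Qed.

Lemma dprojE u w : u \in U -> w \in W -> dproj (u + w) = w.
Proof.
move=> Uu Ww; have /andP[] := xchooseP (decomp (u + w)).
rewrite -/(dproj _) => Wp Up.
apply/esym/eqP; rewrite -subr_eq0; apply/eqP/UW.2; last exact: submodB.
by have := submodB Up Uu; rewrite -[u + w - _]addrA [u + (w - _)]addrC addrK.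
Qed.

Fact dproj_linear : linear dproj.
Proof.
move=> a x y.
have [u [w [Uu Ww ->]]] := UW.1 x; have [u' [w' [Uu' Ww' ->]]] := UW.1 y.
rewrite scalerDr addrACA !dprojE //; first by rewrite rpredD // rpredZ.
by rewrite rpredD // rpredZ.
Qed.

HB.instance Definition _ := GRing.isLinear.Build F V V _ dproj dproj_linear.

End Projection.

Section Phi.
Context (F : fieldType) (T : lieTripleType F) (U : submodClosed T).
Hypothesis UT : direct_sum U (derived T).

(* The value of phi at D computed with the choice D' : on
   a t + (u + b) t^3 with u in U and b in [T,T,T], only b is seen by D'. *)
Definition phi_fun (D D' : {linear T -> T}) (p : breve T) : breve T :=
  tmon (D p.1) 1 + tmon (D' (dproj UT p.2)) 3.

Fact phi_fun_linear D D' : linear (phi_fun D D').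
Proof.
by move=> a p q; congr pair;
  rewrite /= !linearP /= ?addr0 ?add0r.
Qed.

HB.instance Definition _ D D' :=
  GRing.isLinear.Build F (breve T) (breve T) _ (phi_fun D D')
    (phi_fun_linear D D').

Definition phi_with (D D' : {linear T -> T}) : {linear breve T -> breve T} :=
  phi_fun D D'.

Lemma phi_withE D D' (a u b : T) : u \in U -> b \in derived T ->
  phi_with D D' (tmon a 1 + tmon u 3 + tmon b 3) = tmon (D a) 1 + tmon (D' b) 3.
Proof.
move=> Uu Tb; rewrite /phi_with /= /phi_fun /= !addr0.
by congr (_ + tmon (D' _) 3); rewrite add0r dprojE.
Qed.

(* [cid] picks some D' for each D; [phi_with] keeps the choice explicit. *)
Definition phi (D : QDer T) : {linear breve T -> breve T} :=
  phi_with (val D) (projT1 (cid (set_valP D))).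

End Phi.

(* Main.v *)
Require Import Defs.
From mathcomp Require Import all_boot all_algebra.
From mathcomp Require Import boolp classical_sets.

(** The bracket of [breve T] multiplies three factors of positive
degree in [t] and kills [t^4], so it only sees the [t]-components and only
takes values in [T,T,T] t^3.  Hence the derivation identity for [phi(D)] is
an identity between [t^3]-components: on the left [D] acts on the
[t]-components, giving [D x, y, z] + [x, D y, z] + [x, y, D z]; on the right
[D'] acts on the projection of [x, y, z] to [T,T,T], that is on [x, y, z]
itself.  The two agree because [D'] is a companion of [D]; this is
[phi_with_Der].

The companion relation fixes the values of [D'] on brackets, hence, by
linearity, on their span [T,T,T] ([companion_derived]); since [phi(D)] uses
[D'] only after projecting to [T,T,T], the choice of [D'] is immaterial.
Finally [D] is recovered from [phi(D)] as its action on the [t]-component,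
which gives injectivity. *)

Set Implicit Arguments.
Unset Strict Implicit.
Unset Printing Implicit Defensive.

Import GRing.Theory.

Local Open Scope ring_scope.
Local Open Scope classical_set_scope.

(** Bundled linear maps carry proofs, so pointwise equality gives equality only
through functional extensionality and proof irrelevance. *)
Lemma linear_ext (F : fieldType) (V W : lmodType F) (f g : {linear V -> W}) :
  f =1 g -> f = g.
Proof.
case: f => f [[fD] [fZ]]; case: g => g [[gD] [gZ]] /= /funext fg.
case: _ / fg gD gZ => gD gZ.
by rewrite (Prop_irrelevance gD fD) (Prop_irrelevance gZ fZ).
Qed.

Lemma linear_eq_lspan (F : fieldType) (V W : lmodType F) (S : set V)
    (f g : {linear V -> W}) :
  {in S, f =1 g} -> {in lspan S, f =1 g}.
Proof.
move=> fg v /asboolP[n [c [s [Ss ->]]]].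
rewrite !linear_sum; apply: eq_bigr => i _.
by rewrite !linearZ fg // inE.
Qed.

(** The companion relation writes the value of the companion at each bracket in
terms of [D] alone, and brackets span [derived T]. *)
Lemma companion_derived (F : fieldType) (T : lieTripleType F)
    (D D1 D2 : {linear T -> T}) :
  companion D D1 -> companion D D2 -> {in derived T, D1 =1 D2}.
Proof.
move=> D1P D2P; apply: linear_eq_lspan => _ /[!inE] -[x [y [z ->]]].
by rewrite -D1P -D2P.
Qed.

Lemma tribr_derived (F : fieldType) (T : lieTripleType F) (x y z : T) :
  [< x, y, z >] \in derived T.
Proof.
apply/asboolP; exists 1%N, (fun=> 1), (fun=> [< x, y, z >]).
by split=> [_|]; [exists x, y, z | rewrite big_ord1 scale1r].
Qed.

Section Projection.
Context (F : fieldType) (V : lmodType F) (U W : submodClosed V).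
Hypothesis UW : direct_sum U W.

Lemma dproj_in v : dproj UW v \in W.
Proof. by have [u [w [Uu Ww ->]]] := UW.1 v; rewrite dprojE. Qed.

Lemma dproj_id w : w \in W -> dproj UW w = w.
Proof. by move=> Ww; rewrite -[X in dproj _ X]add0r dprojE // rpred0. Qed.

End Projection.

Section Phi.
Context (F : fieldType) (T : lieTripleType F) (U : submodClosed T).
Hypothesis UT : direct_sum U (derived T).
Implicit Types D : {linear T -> T}.

Lemma phi_with_pair D D' (p : breve T) :
  phi_with UT D D' p = (D p.1, D' (dproj UT p.2)).
Proof. by congr pair; rewrite /= ?addr0 ?add0r. Qed.

Lemma phi_with_inj D1 D1' D2 D2' :
  phi_with UT D1 D1' = phi_with UT D2 D2' -> D1 = D2.
Proof.
move=> E; apply: linear_ext => a.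
have : phi_with UT D1 D1' (tmon a 1) = phi_with UT D2 D2' (tmon a 1).
  by rewrite E.
by rewrite !phi_with_pair => -[].
Qed.

Lemma phi_with_companion D D1 D2 :
  companion D D1 -> companion D D2 -> phi_with UT D D1 = phi_with UT D D2.
Proof.
move=> D1P D2P; apply: linear_ext => p; rewrite !phi_with_pair.
by rewrite (companion_derived D1P D2P) ?dproj_in.
Qed.

(** The [t]-components vanish on both sides; in degree 3 the projection inside
[phi_with] fixes each bracket of [T], leaving the companion relation itself. *)
Lemma phi_with_Der D D' :
  companion D D' -> phi_with UT D D' \in Der (breve T).
Proof.
move=> DP; rewrite inE => p q r; rewrite !phi_with_pair.
by congr pair; rewrite /= ?linear0 ?addr0 // dproj_id ?tribr_derived.
Qed.

End Phi.

Theorem proposition4p2 (F : fieldType) (T : lieTripleType F)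
    (U : submodClosed T) (UT : direct_sum U (derived T)) :
  (injective (phi UT) /\
   (forall (D : QDer T) (D' : {linear T -> T}),
      companion (val D) D' -> phi UT D = phi_with UT (val D) D')) /\
  range (phi UT) `<=` Der (breve T).
Proof.
have phiP (D : QDer T) :
    companion (val D) (projT1 (cid (set_valP D))) by case: cid.
split; first split.
- by move=> D1 D2 /phi_with_inj/val_inj.
- by move=> D D'; exact: phi_with_companion.
- by move=> _ [D _ <-]; apply/set_mem/phi_with_Der.
Qed.
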